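(* Let $H$ be a graph of order at least $2$ and let $k$ be a positive integer with $k\le\mathcal{C}(K_1+H)$. The following are equivalent: (i) there exists a $k$-adjacency basis $A$ of $H$ such that $|A\setminus N_H(y)|\ge k$ for all $y\in V(H)$; (ii) $\operatorname{adim}_k(K_1+H)=\operatorname{adim}_k(H)$.
   Context: All graphs are finite and simple; $N_H(y)$ is the open neighbourhood of $y$ in $H$. The join $G+H$ of vertex-disjoint graphs has vertex set $V(G)\cup V(H)$ and edges $E(G)\cup E(H)\cup\{uv:u\in V(G),v\in V(H)\}$; $K_1$ is the one-vertex graph. For a graph $G=(V,E)$, $d_{G,2}(x,y)=\min\{d_G(x,y),2\}$ with $d_G$ the shortest-path distance ($\infty$ between different components). For distinct $x,y$, $\mathcal{C}_G(x,y)=\{z\in V: d_{G,2}(x,z)\ne d_{G,2}(y,z)\}$, $\mathcal{C}(G)=\min_{x\ne y}|\mathcal{C}_G(x,y)|$. A set $S\subseteq V$ is a $k$-adjacency generator if $|S\cap\mathcal{C}_G(x,y)|\ge k$ for all distinct $x,y$; a minimum one is a $k$-adjacency basis, of size $\operatorname{adim}_k(G)$. *)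

(* Defs.v *)
From mathcomp Require Import all_boot.

Set Implicit Arguments.
Unset Strict Implicit.
Unset Printing Implicit Defensive.

Record sgraph := SGraph {
  vertex :> finType;
  edge : rel vertex;
  edge_sym : symmetric edge;
  edge_irrefl : irreflexive edge }.

Definition nbh (G : sgraph) (y : G) : {set G} := [set z | edge y z].

Definition complete1 : sgraph :=
  @SGraph unit (fun _ _ => false) (fun _ _ => erefl) (fun _ => erefl).

Section Join.
Variables G H : sgraph.

Definition join_edge : rel (G + H) := fun u v =>
  match u, v with
  | inl x, inl y => edge x y
  | inr x, inr y => edge x y
  | _, _ => true
  end.

Fact join_edge_sym : symmetric join_edge.
Proof. by case=> x [] y //=; apply: edge_sym. Qed.

Fact join_edge_irrefl : irreflexive join_edge.
Proof. by case=> x /=; apply: edge_irrefl. Qed.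

Definition join : sgraph := SGraph join_edge_sym join_edge_irrefl.
End Join.

Section Distance.
Variable G : sgraph.

Definition walk (x y : G) (n : nat) : bool :=
  [exists p : n.-tuple G, path (@edge G) x p && (last x p == y)].

Fact connect_walk (x y : G) : connect (@edge G) x y -> exists n, walk x y n.
Proof.
case/connectP=> p xp ->; exists (size p).
by apply/existsP; exists (in_tuple p); rewrite xp eqxx.
Qed.

(* [None] encodes infinite distance. *)
Definition dist (x y : G) : option nat :=
  if @idP (connect (@edge G) x y) is ReflectT xy
  then Some (ex_minn (connect_walk xy)) else None.

Definition dist2 (x y : G) : nat :=
  if dist x y is Some d then minn d 2 else 2.

Definition distinguishers (x y : G) : {set G} :=
  [set z | dist2 x z != dist2 y z].

(* The default value #|G| bounds every term, so it does not affect the minimum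
   as soon as G has two distinct vertices. *)
Definition min_distinguishers : nat :=
  \big[minn/#|G|]_(p : G * G | p.1 != p.2) #|distinguishers p.1 p.2|.

Definition adj_generator (k : nat) (S : {set G}) : bool :=
  [forall x, forall y, (x != y) ==> (k <= #|S :&: distinguishers x y|)].

Definition adj_basis (k : nat) (S : {set G}) : bool :=
  adj_generator k S &&
  [forall S' : {set G}, adj_generator k S' ==> (#|S| <= #|S'|)].

(* A k-adjacency generator exists iff [setT] is one; otherwise [adim k] takes
   the meaningless value #|G|. *)
Definition adim (k : nat) : nat :=
  #|[arg min_(S < [set: G] | adj_generator k S) #|S| ]|.

Lemma adim_basis (k : nat) (S : {set G}) : adj_basis k S -> #|S| = adim k.
Proof.
case/andP=> genS /forallP minS; rewrite /adim.
case: arg_minnP => [|B genB minB].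
  apply/'forall_forallP=> x y; apply/implyP=> xy; rewrite setTI.
  have /forallP/(_ x)/forallP/(_ y)/implyP/(_ xy) := genS.
  by move=> /leq_trans-> //; rewrite subset_leq_card ?subsetIr.
by apply/eqP; rewrite eqn_leq minB // andbT; apply: (implyP (minS B)).
Qed.
End Distance.

(* Main.v *)
(** For [S] a set of vertices of [K_1 + H] with trace [A] on [H], two vertices of
    [H] are distinguished by the same vertices in [H] and in [K_1 + H], while the
    apex and [y] are distinguished by the apex and the non-neighbours of [y].
    Hence [S] is a k-adjacency generator iff [A] is one and
    [|S :&: K_1| + |A :\: N(y)| >= k] for all [y].  So [adim] of the join is at
    least [adim] of [H], and a basis attaining equality must avoid the apex. *)
Require Import Defs.
From mathcomp Require Import all_boot.

Set Implicit Arguments.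
Unset Strict Implicit.
Unset Printing Implicit Defensive.

(** Passing to the filtered index list turns [P i] into a membership, on which the induction runs;
    the default [n] can only lower the minimum. *)
Lemma leq_bigmin (I : finType) (P : pred I) (F : I -> nat) (n k : nat) (i : I) :
  k <= \big[minn/n]_(j | P j) F j -> P i -> k <= F i.
Proof.
rewrite -big_filter => + Pi; have : i \in [seq j <- index_enum I | P j].
  by rewrite mem_filter Pi mem_index_enum.
elim: [seq j <- _ | _] => //= j s IHs; rewrite inE big_cons leq_min.
by case/predU1P=> [-> /andP[]|/IHs IH /andP[_ /IH]].
Qed.

Lemma walk0 (G : sgraph) (x y : G) : walk x y 0 = (x == y).
Proof.
apply/existsP/eqP => [[p]|->]; last by exists [tuple]; rewrite /= eqxx.
by rewrite tuple0 => /eqP.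
Qed.

Lemma walk1 (G : sgraph) (x y : G) : walk x y 1 = edge x y.
Proof.
apply/existsP/idP => [[p]|xy]; last by exists [tuple y]; rewrite /= xy eqxx.
by case: p => -[|z []] //= _; rewrite andbT => /andP[xz /eqP <-].
Qed.

(** Truncation at 2 merges all larger distances with the infinite one, so only walks of length 0 and
    1 matter. *)
Lemma dist2E (G : sgraph) (x y : G) :
  dist2 x y = if x == y then 0 else if edge x y then 1 else 2.
Proof.
rewrite /dist2 /dist -walk0 -walk1.
case: {-}_ / idP => [xy|nxy].
  case: ex_minnP => d wd mind.
  case: ifPn => [/mind|w0]; first by rewrite leqn0 => /eqP ->.
  have d_gt0 : 0 < d by case: d wd {mind} w0 => // ->.
  case: ifPn => [/mind d_le1|w1].
    by have -> : d = 1 by apply/eqP; rewrite eqn_leq d_le1.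
  by case: d wd d_gt0 w1 {mind w0} => [|[|d]] // ->.
rewrite walk0 walk1; case: eqP => [exy|_]; first by case: nxy; rewrite exy connect0.
by case: ifP => // /connect1.
Qed.

Lemma adj_generatorP (G : sgraph) (k : nat) (S : {set G}) :
  reflect (forall x y, x != y -> k <= #|S :&: distinguishers x y|)
          (adj_generator k S).
Proof.
apply: (iffP forallP) => [gS x y|gS x]; first by move/forallP/(_ y)/implyP: (gS x).
by apply/forallP => y; apply/implyP; apply: gS.
Qed.

Lemma adj_generatorT (G : sgraph) (k : nat) :
  k <= min_distinguishers G -> adj_generator k [set: G].
Proof.
move=> kC; apply/adj_generatorP => x y xy; rewrite setTI.
exact: (leq_bigmin (i := (x, y)) kC).
Qed.

Lemma adim_min (G : sgraph) (k : nat) (S : {set G}) :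
  adj_generator k S -> adim G k <= #|S|.
Proof.
(* The default value of [adim] is excluded: enlarging [S] to the whole vertex set keeps it a
   generator. *)
move=> gS; rewrite /adim; case: arg_minnP => [|B _]; last exact.
apply/adj_generatorP => x y /(adj_generatorP _ _ gS) /leq_trans -> //.
by rewrite subset_leq_card // setSI // subsetT.
Qed.

Lemma adj_basisE (G : sgraph) (k : nat) (S : {set G}) :
  adj_basis k S = adj_generator k S && (#|S| == adim G k).
Proof.
apply/idP/andP => [bS|[gS /eqP cS]].
  by rewrite (adim_basis bS) eqxx; case/andP: bS.
by apply/andP; split=> //; apply/forallP => B; apply/implyP; rewrite cS; apply: adim_min.
Qed.

Lemma adj_basis_exists (G : sgraph) (k : nat) :
  adj_generator k [set: G] -> exists S : {set G}, adj_basis k S.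
Proof.
move=> gT; exists [arg min_(S < [set: G] | adj_generator k S) #|S|].
by rewrite adj_basisE eqxx andbT; case: arg_minnP.
Qed.

Section Join1.
Variable H : sgraph.
Local Notation J := (join complete1 H).
Implicit Types (S : {set J}) (x y : H).

Definition trace S : {set H} := [set y | (inr y : J) \in S].

Lemma card_join1 S : #|S| = ((inl tt : J) \in S) + #|trace S|.
Proof.
rewrite -sum1_card big_sumType /= big_mkcond (big_pred1 tt); last by case.
congr addn.
by rewrite -sum1_card; apply: eq_bigl => y; rewrite inE.
Qed.

(** The apex is adjacent to both [x] and [y], and [dist2] depends only on equality and adjacency,
    which the join preserves on [H]. *)
Lemma trace_distinguishersE S x y :
  #|S :&: distinguishers (inr x : J) (inr y)| = #|trace S :&: distinguishers x y|.
Proof.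
rewrite card_join1 !inE !dist2E /= andbF add0n; apply: eq_card => z.
by rewrite !inE !dist2E.
Qed.

Lemma apex_distinguishersE S y :
  #|S :&: distinguishers (inl tt : J) (inr y)| =
  ((inl tt : J) \in S) + #|trace S :\: nbh y|.
Proof.
rewrite card_join1 !inE !dist2E /= andbT; congr addn; apply: eq_card => z.
rewrite !inE !dist2E /= andbC; congr andb.
(* The vertex [y] itself counts: it has distance 1 from the apex and 0 from itself, and lies outside
   [nbh y] by irreflexivity. *)
rewrite (inj_eq (@inr_inj _ _)); case: (y =P z) => [->|_];
  first by rewrite edge_irrefl.
by case: ifP.
Qed.

Lemma adj_generator_join1P k S :
  reflect (adj_generator k (trace S) /\
           forall y, k <= ((inl tt : J) \in S) + #|trace S :\: nbh y|)
          (adj_generator k S).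
Proof.
apply: (iffP (adj_generatorP k S)) => [gS|[gS apexS] [[]|x] [[]|y] //= xy].
- split=> [|y]; last by rewrite -apex_distinguishersE gS.
  by apply/adj_generatorP => x y xy; rewrite -trace_distinguishersE gS.
- by rewrite apex_distinguishersE.
- have -> : distinguishers (inr x : J) (inl tt) = distinguishers (inl tt : J) (inr x).
    by apply/setP => z; rewrite !inE eq_sym.
  by rewrite apex_distinguishersE.
- by rewrite trace_distinguishersE; apply: (adj_generatorP _ _ gS).
Qed.

Lemma trace_imset (A : {set H}) : trace [set inr y | y in A] = A.
Proof. by apply/setP => y; rewrite inE mem_imset //; apply: inr_inj. Qed.

End Join1.

Theorem theorem26 (H : sgraph) (k : nat)
  (hH : 2 <= #|H|) (hk : 0 < k)
  (hkC : k <= min_distinguishers (join complete1 H)) :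
  (exists A : {set H}, adj_basis k A /\ forall y : H, k <= #|A :\: nbh y|)
  <-> adim (join complete1 H) k = adim H k.
Proof.
have [S] := adj_basis_exists (adj_generatorT hkC).
rewrite adj_basisE => /andP[/adj_generator_join1P[gS apexS] /eqP cS].
have leS := adim_min gS; rewrite card_join1 in cS; split=> [[A []]|eq_adim].
  rewrite adj_basisE => /andP[gA /eqP cA] apexA.
  (* The trace of [S] gives one inequality; for the other, the copy of [A] in the join is a
     generator without the apex. *)
  apply/eqP; rewrite eqn_leq -{2}cS (leq_trans leS) ?leq_addl // andbT.
  rewrite -cA -(card_imset A (@inr_inj unit H)); apply: adim_min.
  apply/adj_generator_join1P; rewrite trace_imset; split=> // y.
  exact: leq_trans (apexA y) (leq_addl _ _).
(* The trace alone already has at least [adim H k] elements, which is all of [#|S|]. *)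
have S_apex : ((inl tt : join complete1 H) \in S) = 0 :> nat.
  by apply/eqP; rewrite -leqn0 -(leq_add2r #|trace S|) cS eq_adim.
exists (trace S); rewrite adj_basisE gS -eq_adim -cS S_apex eqxx; split=> // y.
by have := apexS y; rewrite S_apex.
Qed.
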